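(* Let $N\ge 1$ be an integer and let $\eta\in\mathbb{C}$ be any primitive $2N$-th root of $1$. Let $S_{H}$ denote the space of functions $f\in C(\mathbb{C},\mathbb{C})$ which satisfy $$\sum_{k=0}^{N-1}f(x+\eta^{2k}y)=\sum_{k=0}^{N-1}f(x+\eta^{2k+1}y)\quad\text{for all } x,y\in\mathbb{C}.$$ Then $$S_{H}=\Big\{f(z)=\sum_{i=0}^{N-1}\sum_{j=0}^{N-1}a_{i,j}z^i\overline{z}^j : a_{i,j}\in\mathbb{C}\text{ for all } 0\leq i,j\leq N-1\Big\}.$$
   Context: $C(\mathbb{C},\mathbb{C})$ denotes the space of continuous functions $f:\mathbb{C}\to\mathbb{C}$, and $\overline{z}$ is the complex conjugate of $z$. The functional equation in the statement is called the Haruki equation. *)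

(* Defs.v *)
From mathcomp Require Import all_boot all_order all_algebra.
From mathcomp Require Import complex.
From mathcomp Require Import all_classical all_reals all_analysis.

Set Implicit Arguments.
Unset Strict Implicit.
Unset Printing Implicit Defensive.

Import GRing.Theory Num.Theory numFieldNormedType.Exports.

Local Open Scope ring_scope.
Local Open Scope classical_set_scope.

Definition haruki_equation (R : realType) (N : nat) (eta : R[i])
    (f : R[i] -> R[i]) : Prop :=
  forall x y : R[i],
    \sum_(k < N) f (x + eta ^+ (2 * k) * y) =
    \sum_(k < N) f (x + eta ^+ (2 * k + 1) * y).

(* The topology on the complex numbers [R[i]] is that of the norm [`|z|]; the
   library attaches it to the alias [R[i]^o], hence the type annotation. *)
Definition haruki_space (R : realType) (N : nat) (eta : R[i]) :
    set (R[i] -> R[i]) :=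
  [set f | continuous (f : R[i]^o -> R[i]^o) /\ haruki_equation N eta f].

Definition bipolynomial_space (R : realType) (N : nat) : set (R[i] -> R[i]) :=
  [set f | exists a : 'M[R[i]]_N,
     f = (fun z => \sum_(i < N) \sum_(j < N) a i j * z ^+ i * z^*%C ^+ j)].
Arguments bipolynomial_space R N : clear implicits.

(* Main.v *)
Require Import Defs.
From mathcomp Require Import all_boot all_order all_algebra.
From mathcomp Require Import complex.
From mathcomp Require Import all_classical all_reals all_analysis.
From mathcomp Require Import ring qpoly.

(** That the polynomials in [z] and [z^*] of degree less than [N] in each
    variable solve the equation is a computation: expanding
    [(x + eta^k y)^i (x + eta^k y)^*^j], the coefficient of each monomial in
    [y] and [y^*] carries an alternating sum of powers of
    [eta ^+ s * eta^* ^+ t] with [s, t < N], a geometric sum that vanishes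
    because [-1] is not of that form ([alternating_monomial_sum]).

    For the converse, write the equation as
    [\sum_(k < 2N) (-1)^k f (x + eta^k y) = 0].  No smoothness is available,
    so derivatives are replaced by finite differences.

    - Comparing the equation at [(x, y)] and at [(x - eta^l t, y + t)] cancels
      the [l]-th term and replaces each other term by a difference of it.  The
      numbers [eta^k] being distinct, all terms but the first can be removed in
      this way, and [f] is killed by every [(2N-1)]-fold difference
      ([eliminate_terms], [haruki_fdiff]).
    - A sequence whose [m]-th difference is zero is a polynomial of degree less
      than [m].  On the grids [(1/q) Z] of a line these polynomials have to
      agree, as they agree on the integers; so by continuity [f] is a
      polynomial on every real line ([poly_on_real_lines]).  Lagrange
      interpolation in both real coordinates makes it a polynomial in the
      pair of them ([haruki_real_bipoly]), thus [f z = F z z^*] for a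
      polynomial [F] in two variables.
    - A polynomial in [(u, v)] that vanishes whenever [v = u^*] vanishes
      identically ([eq0_on_conjugates]).  Used for [x] with its conjugate and
      then for [y] with its conjugate, this makes the four arguments
      independent in the equation for [F]; putting the increment of the second
      argument equal to zero leaves
      [\sum_k (-1)^k F (u + eta^k y) v = 0].  In its Taylor expansion the
      coefficient of [y^N] is [2N] times the [N]-th derivative of [F] in [u],
      because [eta^N = -1].  That derivative therefore vanishes
      ([size_le_of_alternating_sum]), so [F] has degree less than [N] in [u],
      and by symmetry in [v].  A second interpolation gives the coefficients
      ([haruki_bipoly]). *)

Set Implicit Arguments.
Unset Strict Implicit.
Unset Printing Implicit Defensive.

Import Order.TTheory GRing.Theory Num.Theory numFieldNormedType.Exports.

Local Open Scope ring_scope.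
Local Open Scope complex_scope.

(** * Finite differences *)

Definition fdiff (U : nmodType) (V : zmodType) (h : U) (f : U -> V) : U -> V :=
  fun x => f (x + h) - f x.

(** Subtracting the equation at [(x, y)] from the one at
    [(x - a_n t, y + t)] removes the [n]-th term and turns [g k] into its
    difference with step [(a k - a_n) t].  The step for [k = 0] can be made
    equal to any [h], and induction applies to the differences.  The functions
    [g k] are allowed to differ for the sake of this induction. *)
Lemma eliminate_terms (K : fieldType) (V : zmodType) (n : nat) (a : nat -> K)
    (g : nat -> K -> V) :
  {in [pred k | (k <= n)%N] &, injective a} ->
  (forall x y, \sum_(k < n.+1) g k (x + a k * y) = 0) ->
  forall h x, iter n (fdiff h) (g 0) x = 0.
Proof.
elim: n g => [|n IHn] g inj_a sum0 h x /=.
  by have := sum0 x 0; rewrite big_ord1 mulr0 addr0.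
have a0n : a 0 - a n.+1 != 0.
  by rewrite subr_eq0; apply/eqP => /inj_a; rewrite !inE => /(_ isT (leqnn _)).
set t := h / (a 0 - a n.+1).
pose g' k := fdiff ((a k - a n.+1) * t) (g k).
have g'0 : g' 0 = fdiff h (g 0).
  by rewrite /g' /t mulrCA divff ?mulr1.
rewrite -iterS iterSr -g'0; apply: (IHn g') => [k l|x' y].
  by rewrite !inE => kn ln; apply: inj_a; rewrite inE leqW.
have := congr2 (fun u v => u - v) (sum0 (x' - a n.+1 * t) (y + t)) (sum0 x' y).
rewrite subr0 -sumrB big_ord_recr /= => E; rewrite -[RHS]E.
have -> : x' - a n.+1 * t + a n.+1 * (y + t) = x' + a n.+1 * y by ring.
rewrite subrr addr0; apply: eq_bigr => k _; rewrite /g' /fdiff.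
by congr (g k _ - _); ring.
Qed.

(** Newton's forward difference formula.  The induction is on the argument, for
    all sequences at once: the series of [u n.+1] is the sum of those of [u] and
    of its difference at [n], by Pascal's rule. *)
Lemma newton_series (V : zmodType) (m : nat) (u : nat -> V) :
  (forall n, iter m (fdiff 1%N) u n = 0) ->
  forall n, u n = \sum_(i < m) iter i (fdiff 1%N) u 0%N *+ 'C(n, i).
Proof.
case: m => [u0 n|m um n]; first by rewrite big_ord0; apply: u0.
elim: n u um => [|n IHn] u um.
  by rewrite big_ord_recl bin0 /= mulr1n big1 ?addr0.
have -> : u n.+1 = u n + fdiff 1%N u n.
  by rewrite -addn1 /fdiff [RHS]addrC subrK.
rewrite (IHn u um) (IHn (fdiff 1%N u)); last first.
  move=> k; rewrite -iterSr iterS.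
  exact: etrans (congr2 (fun a b => a - b) (um _) (um _)) (subrr 0).
rewrite [X in _ + X]big_ord_recr /= -iterSr um mul0rn addr0.
rewrite !big_ord_recl /= !bin0 !mulr1n -addrA -big_split /=.
congr (_ + _); apply: eq_bigr => i _.
by rewrite -iterSr binS mulrnDr.
Qed.

Lemma poly_of_nat_fdiff (K : numFieldType) (m : nat) (u : nat -> K) :
  (forall n, iter m (fdiff 1%N) u n = 0) ->
  exists2 p : {poly K}, (size p <= m)%N & forall n, u n = p.[n%:R].
Proof.
move=> um.
(* The falling factorial as a polynomial, so that
   [b i / i!] interpolates the binomial coefficients. *)
pose b i : {poly K} := \prod_(j < i) ('X - j%:R%:P).
have bE i n : (b i).[n%:R] = (n ^_ i)%:R.
  rewrite /b; elim: i => [|i IHi]; first by rewrite big_ord0 hornerC.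
  rewrite big_ord_recr hornerM IHi !hornerE ffactnSr natrM.
  have [ni|ni] := leqP i n; first by rewrite natrB.
  by rewrite ffact_small // !mul0r.
exists (\sum_(i < m) (iter i (fdiff 1%N) u 0%N / i`!%:R) *: b i).
  apply: (leq_trans (size_sum _ _ _)); apply/bigmax_leqP => i _.
  apply: (leq_trans (size_scale_leq _ _)).
  by rewrite /b size_prod_XsubC /index_enum -enumT size_enum_ord ltn_ord.
move=> n; rewrite (newton_series um) horner_sum; apply: eq_bigr => i _.
rewrite hornerZ bE -bin_ffact natrM mulrA mulrAC divfK ?mulr_natr //
  pnatr_eq0 -lt0n fact_gt0.
Qed.

(** * Polynomials and grids *)

Lemma poly_eq0_seq (K : idomainType) (p : {poly K}) (a : nat -> K) :
  injective a -> (forall n, p.[a n] = 0) -> p = 0.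
Proof.
move=> inj_a pa0; apply: (roots_geq_poly_eq0 (rs := mkseq a (size p))).
- by apply/allP => _ /mapP [n _ ->]; apply/rootP.
- exact: mkseq_uniq.
- by rewrite size_mkseq.
Qed.

Lemma natr_injective (K : numDomainType) : injective (fun n => n%:R : K).
Proof. by move=> m n /eqP; rewrite eqr_nat => /eqP. Qed.

Lemma iter_fdiff_comp (U V : nmodType) (W : zmodType) (f : V -> W) (g : U -> V)
    (h : U) (k : V) (m : nat) (x : U) :
  (forall x, g (x + h) = g x + k) ->
  iter m (fdiff h) (f \o g) x = iter m (fdiff k) f (g x).
Proof. by move=> gD; elim: m x => //= m IHm x; rewrite /fdiff !IHm gD. Qed.

(** One polynomial serves all grids: on the grid of step [1/q] starting at the
    integer [-M], the function is some polynomial, which agrees with the one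
    found on the natural numbers at infinitely many points.  Starting at [-M]
    is what reaches the negative arguments. *)
Lemma poly_on_grids (K : numFieldType) (m : nat) (g : K -> K) :
  (forall h x, iter m (fdiff h) g x = 0) ->
  exists2 p : {poly K}, (size p <= m)%N &
    forall M n q : nat, (0 < q)%N ->
      g (n%:R / q%:R - M%:R) = p.[n%:R / q%:R - M%:R].
Proof.
move=> gm.
have grid (x0 h : K) : exists2 p : {poly K}, (size p <= m)%N &
    forall n : nat, g (n%:R * h + x0) = p.[n%:R].
  apply: (poly_of_nat_fdiff (u := g \o (fun n : nat => n%:R * h + x0))) => n.
  rewrite (@iter_fdiff_comp _ _ _ g _ _ h) // => k.
  by rewrite natrD; ring.
have [p szp gp] := grid 0 1; exists p => // M n q q_gt0.
have [r szr gr] := grid (- M%:R) q%:R^-1.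
have q0 : (q%:R : K) != 0 by rewrite pnatr_eq0 -lt0n.
have {}gp k : g k%:R = p.[k%:R] by rewrite -gp mulr1 addr0.
have rp : r - (p \Po (q%:R^-1 *: 'X - M%:R%:P)) = 0.
  apply: (poly_eq0_seq (a := fun k => (q * (k + M))%N%:R)).
    move=> k l /natr_injective /eqP.
    by rewrite eqn_pmul2l // eqn_add2r => /eqP.
  move=> k; rewrite hornerD hornerN horner_comp !hornerE -gr -[_ / _]mulrC.
  by rewrite natrM mulKf // natrD addrK gp subrr.
rewrite gr (subr0_eq rp) horner_comp !hornerE.
by rewrite mulrC.
Qed.

Lemma poly_on_rats (K : numFieldType) (m : nat) (g : K -> K) :
  (forall h x, iter m (fdiff h) g x = 0) ->
  exists2 p : {poly K}, (size p <= m)%N &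
    forall q : rat, g (ratr q) = p.[ratr q].
Proof.
move=> /poly_on_grids [p szp gp]; exists p => // q.
have den_gt0 : (0 < `|denq q|)%N by rewrite absz_gt0 denq_neq0.
(* [q = n / d - M] with [d] the denominator and [M] the absolute value of the
   numerator, which is large enough to make [n] nonnegative. *)
have num_ge : 0 <= numq q + `|numq q| * denq q.
  rewrite -lerBlDl sub0r; apply: le_trans (_ : `|numq q| <= _).
    by rewrite -normrN ler_norm.
  by rewrite ler_peMr // -gtz0_ge1 denq_gt0.
suff -> : ratr q = `|numq q + `|numq q| * denq q|%R%:~R / (`|denq q|%N)%:R
                   - (`|numq q|%N)%:R :> K.
  by rewrite -natr_absz; exact: gp.
have den0 : (denq q)%:~R != 0 :> K by rewrite intr_eq0 denq_neq0.
rewrite !natr_absz (ger0_norm num_ge) [`|denq q|]ger0_norm ?denq_ge0 //.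
by rewrite intrD intrM mulrDl mulfK // addrK.
Qed.

(** * Continuous functions on the complex plane *)

Definition continuousC (R : realType) (f : R[i] -> R[i]) : Prop :=
  continuous (f : R[i]^o -> R[i]^o).
Section ContinuousC.
Variable R : realType.
Implicit Types f g : R[i] -> R[i].

Lemma continuousC_cst (c : R[i]) : continuousC (fun=> c).
Proof. exact: (@cst_continuous R[i]^o R[i]^o). Qed.

Lemma continuousC_id : continuousC (fun z : R[i] => z).
Proof. by move=> z; exact: cvg_id. Qed.

Lemma continuousC_add f g :
  continuousC f -> continuousC g -> continuousC (fun z => f z + g z).
Proof. by move=> fc gc x; exact: (continuousD (fc x) (gc x)). Qed.

Lemma continuousC_mul f g :
  continuousC f -> continuousC g -> continuousC (fun z => f z * g z).
Proof. by move=> fc gc x; exact: (continuousM (fc x) (gc x)). Qed.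

Lemma continuousC_comp f g :
  continuousC f -> continuousC g -> continuousC (fun z => g (f z)).
Proof. by move=> fc gc x; exact: (continuous_comp (fc x) (gc (f x))). Qed.

Lemma continuousC_conj : continuousC (fun z : R[i] => z^*%C).
Proof.
move=> x A /nbhs_ballP [e e0 sA]; apply/nbhs_ballP; exists e => // z xz.
by apply: sA; rewrite /ball /= -rmorphB normcJ.
Qed.

Lemma continuousC_exp f n : continuousC f -> continuousC (fun z => f z ^+ n).
Proof.
move=> fc; elim: n => [|n IHn]; first exact: continuousC_cst.
rewrite (_ : (fun z => _) = (fun z => f z * f z ^+ n)).
  exact: continuousC_mul.
by apply/funext => z; rewrite exprS.
Qed.

Lemma continuousC_sum n (F : 'I_n -> R[i] -> R[i]) :
  (forall i, continuousC (F i)) -> continuousC (fun z => \sum_(i < n) F i z).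
Proof.
move=> Fc; apply: (@continuous_big R[i]^o 'I_n _ 0 xpredT _ R[i]^o _
  (fun i => F i : R[i]^o -> R[i]^o)) => [|i _]; last exact: Fc.
exact: (@add_continuous R[i]^o).
Qed.

Lemma continuousC_horner (p : {poly R[i]}) : continuousC (horner p).
Proof.
rewrite (_ : horner p = fun z => \sum_(i < size p) p`_i * z ^+ i); last first.
  by apply/funext => z; rewrite horner_coef.
apply: continuousC_sum => i.
apply: continuousC_mul; first exact: continuousC_cst.
exact/continuousC_exp/continuousC_id.
Qed.

Lemma continuous_eq0_real (h : R[i] -> R[i]) :
  continuousC h -> (forall q : rat, h (ratr q) = 0) ->
  forall s : R, h s%:C = 0.
Proof.
move=> hc h0 s.
have h0_closed : closed ((h : R[i]^o -> R[i]^o) @^-1` [set 0])%classic.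
  apply: preimage_closed => [x _|]; first exact: hc.
  apply/accessible_closed_set1/hausdorff_accessible.
  exact: (@norm_hausdorff _ R[i]^o).
apply: h0_closed => B /nbhs_ballP [e e0 sB].
have {e0} : 0 < e by [].
rewrite ltcE /= => /andP [/eqP Im_e Re_e].
have [q] : exists q : rat, ratr q \in `]s, (s + complex.Re e)[.
  by apply: rat_in_itvoo; rewrite ltrDl.
rewrite in_itv /= => /andP [sq qs].
exists (ratr q); split; first exact: h0.
apply: sB; rewrite /ball /= -(fmorph_rat (real_complex R)).
rewrite -(rmorphB (real_complex R)) normc_def /= expr0n addr0 sqrtr_sqr ltcE /=.
by rewrite Im_e eqxx /= distrC gtr0_norm ?subr_gt0 // ltrBlDl.
Qed.

(** Fréchet's theorem on a line: the difference equation gives the polynomial at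
    rational parameters, and continuity carries it to the real ones. *)
Lemma poly_on_real_lines (m : nat) (f : R[i] -> R[i]) :
  continuousC f ->
  (forall h x, iter m (fdiff h) f x = 0) ->
  forall x v, exists2 p : {poly R[i]}, (size p <= m)%N &
    forall s : R, f (x + v * s%:C) = p.[s%:C].
Proof.
move=> fc fm x v.
have [h w|p szp gp] := @poly_on_rats _ m (f \o (fun w => x + v * w)).
  rewrite (@iter_fdiff_comp _ _ _ _ _ _ (v * h)) // => {}w.
  by rewrite mulrDr addrA.
exists p => // s; apply/eqP; rewrite -subr_eq0; apply/eqP.
apply: (continuous_eq0_real (h := fun w => f (x + v * w) - p.[w])) => [|q].
  apply: continuousC_add.
    apply: (continuousC_comp (f := fun w => x + v * w)) => //.
    apply: continuousC_add; first exact: continuousC_cst.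
    by apply: continuousC_mul; [exact: continuousC_cst|exact: continuousC_id].
  rewrite (_ : (fun z => - p.[z]) = horner (- p)).
    exact: continuousC_horner.
  by apply/funext => z; rewrite hornerN.
by rewrite -gp subrr.
Qed.

End ContinuousC.

(** * Polynomials in two variables *)

Definition bipoly (K : comPzRingType) (n : nat) (a : 'M[K]_n) (u v : K) : K :=
  \sum_(i < n) \sum_(j < n) a i j * u ^+ i * v ^+ j.

Lemma bipoly_mulmx (K : comPzRingType) (n : nat) (a : 'M[K]_n) (u v : K) :
  bipoly a u v =
  ((\row_(i < n) u ^+ i) *m a *m (\col_(j < n) v ^+ j)) ord0 ord0.
Proof.
rewrite mxE /bipoly exchange_big; apply: eq_bigr => j _ /=.
rewrite !mxE mulr_suml; apply: eq_bigr => i _; rewrite !mxE.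
by rewrite [_ * a i j]mulrC.
Qed.

(** Interpolating at [0, ..., n - 1] in both variables expresses [G] through its
    values at the integer points of a square.  The set [T] lets the same
    statement serve for real arguments and for all complex ones. *)
Lemma bipoly_interpolation (K : numFieldType) (T : K -> Prop) (n : nat)
    (G : K -> K -> K) :
  (forall k : nat, T k%:R) ->
  (forall v, T v -> exists2 p : {poly K}, (size p <= n)%N &
     forall u, T u -> G u v = p.[u]) ->
  (forall u, T u -> exists2 p : {poly K}, (size p <= n)%N &
     forall v, T v -> G u v = p.[v]) ->
  exists a : 'M[K]_n, forall u v, T u -> T v -> G u v = bipoly a u v.
Proof.
case: n => [|n] Tnat Gu Gv.
  exists 0 => u v Tu Tv; have [p] := Gu v Tv.
  rewrite leqn0 size_poly_eq0 => /eqP -> -> //.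
  by rewrite horner0 /bipoly big_ord0.
pose l (k : 'I_n.+1) : {poly K} :=
  tnth (lagrange n.+1 (fun i => i%:R : K)) k.
have lE (p : {poly K}) u : (size p <= n.+1)%N ->
    p.[u] = \sum_(k < n.+1) p.[k%:R] * (l k).[u].
  move=> szp.
  rewrite [p in LHS](lagrange_gen (ltn0Sn n) (@natr_injective K) szp).
  by rewrite horner_sum; apply: eq_bigr => k _; rewrite hornerM hornerC.
pose L := \matrix_(k < n.+1, i < n.+1) (l k)`_i.
have lL k u : (l k).[u] = \sum_(i < n.+1) u ^+ i * L k i.
  rewrite (@horner_coef_wide _ n.+1); last first.
    by rewrite size_lagrange_ //; exact: natr_injective.
  by apply: eq_bigr => i _; rewrite mxE mulrC.
(* [L] is the change of basis from the Lagrange polynomials to the monomials,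
   so the coefficients are the values [g], transformed on both sides. *)
pose g := \matrix_(k < n.+1, j < n.+1) G k%:R j%:R.
exists (L^T *m g *m L) => u v Tu Tv.
have Lrow w : (\row_(i < n.+1) w ^+ i) *m L^T = \row_k (l k).[w].
  apply/rowP => k; rewrite !mxE lL; apply: eq_bigr => i _.
  by rewrite !mxE.
have Lcol w : L *m (\col_(i < n.+1) w ^+ i) = \col_k (l k).[w].
  apply/colP => k; rewrite !mxE lL; apply: eq_bigr => i _.
  by rewrite !mxE mulrC.
rewrite bipoly_mulmx !mulmxA Lrow -!mulmxA Lcol mulmxA mxE.
have [p szp Gp] := Gu v Tv.
rewrite Gp // lE // (eq_bigr (fun k : 'I_n.+1 => \sum_(j < n.+1)
   (l k).[u] * G k%:R j%:R * (l j).[v])) => [|k _].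
  rewrite exchange_big; apply: eq_bigr => j _ /=.
  by rewrite !mxE mulr_suml; apply: eq_bigr => k _; rewrite !mxE.
have [q szq Gq] := Gv k%:R (Tnat k).
rewrite -Gp // Gq // lE // mulrC mulr_sumr; apply: eq_bigr => j _.
by rewrite -Gq // mulrA.
Qed.

(** This weak form of being a polynomial in two variables is stable under sums
    and affine substitutions for immediate reasons, and is all that the
    vanishing argument below needs. *)
Definition poly_along_lines (K : nzRingType) (G : K -> K -> K) : Prop :=
  forall a b c d, exists p : {poly K},
    forall w, G (a + b * w) (c + d * w) = p.[w].

Lemma poly_along_lines_bipoly (K : comNzRingType) (n : nat) (a : 'M[K]_n) :
  poly_along_lines (bipoly a).
Proof.
move=> x b y d.
exists (bipoly (map_mx polyC a) (x%:P + b%:P * 'X) (y%:P + d%:P * 'X)) => w.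
rewrite horner_sum; apply: eq_bigr => i _; rewrite horner_sum.
by apply: eq_bigr => j _; rewrite !(hornerE, horner_exp) mxE hornerC.
Qed.

Lemma poly_along_lines_affine (K : comNzRingType) (G : K -> K -> K)
    (a11 a12 a21 a22 b1 b2 : K) :
  poly_along_lines G ->
  poly_along_lines (fun u v =>
    G (b1 + a11 * u + a12 * v) (b2 + a21 * u + a22 * v)).
Proof.
move=> GP a b c d.
have [p Gp] := GP (b1 + a11 * a + a12 * c) (a11 * b + a12 * d)
  (b2 + a21 * a + a22 * c) (a21 * b + a22 * d).
by exists p => w; rewrite -Gp; congr G; ring.
Qed.

Lemma poly_along_lines_scale (K : comNzRingType) (G : K -> K -> K) (c0 : K) :
  poly_along_lines G -> poly_along_lines (fun u v => c0 * G u v).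
Proof.
move=> GP a b c d; have [p Gp] := GP a b c d.
by exists (c0 *: p) => w; rewrite hornerZ Gp.
Qed.

Lemma poly_along_lines_sum (K : comNzRingType) (n : nat)
    (G : 'I_n -> K -> K -> K) :
  (forall k, poly_along_lines (G k)) ->
  poly_along_lines (fun u v => \sum_(k < n) G k u v).
Proof.
move=> GP a b c d; have [p Gp] := fin_all_exists (fun k => GP k a b c d).
exists (\sum_(k < n) p k) => w.
by rewrite horner_sum; apply: eq_bigr => k _; exact: Gp.
Qed.

(** The function [G (s + 'i t) (s - 'i t)] vanishes for real [s] and [t], where
    the two arguments are conjugate.  Being a polynomial in [s] and in [t], it
    vanishes for complex ones too, and these parametrize all pairs [(u, v)]. *)
Lemma eq0_on_conjugates (R : realType) (G : R[i] -> R[i] -> R[i]) :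
  poly_along_lines G -> (forall z, G z z^* = 0) -> forall u v, G u v = 0.
Proof.
move=> GP G0.
have poly0 (p : {poly R[i]}) : (forall n : nat, p.[n%:R] = 0) -> p = 0.
  exact: poly_eq0_seq (@natr_injective _).
have step1 (t : nat) w : G (w + 'i * t%:R) (w - 'i * t%:R) = 0.
  have [p Gp] := GP ('i * t%:R) 1 (- ('i * t%:R)) 1.
  rewrite addrC [w - _]addrC -[w]mul1r Gp (poly0 p) ?horner0 // => n.
  rewrite -Gp !mul1r -[RHS](G0 (n%:R + 'i * t%:R)) addrC [_ + n%:R]addrC.
  congr G; rewrite rmorphD rmorphM !rmorph_nat -mulNr; congr (_ + _ * _).
  by apply/eqP; rewrite eq_complex /= oppr0 !eqxx.
have step2 t w : G (w + 'i * t) (w - 'i * t) = 0.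
  have [p Gp] := GP w 'i w (- 'i).
  by rewrite -mulNr Gp (poly0 p) ?horner0 // => n; rewrite -Gp mulNr step1.
move=> u v; rewrite -[RHS](step2 ((u - v) / (2 * 'i)) ((u + v) / 2)).
have i0 : 'i != 0 :> R[i] by rewrite eq_complex /= oner_eq0 andbF.
by congr G; field; rewrite i0.
Qed.

(** The Taylor expansion at [u], sorted by powers of [y], has at [y ^ N] the
    coefficient [p^`N(N).[u]] times the sum of [(-1)^k z^(k N) = 1] over
    [k < 2N], so the [N]-th derivative of [p] is zero. *)
Lemma size_le_of_alternating_sum (K : numFieldType) (N : nat) (z : K)
    (p : {poly K}) :
  z ^+ N = -1 ->
  (forall u y, \sum_(k < 2 * N) (-1) ^+ k * p.[u + z ^+ k * y] = 0) ->
  (size p <= N)%N.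
Proof.
move=> zN sum0; case: (posnP N) => [N0|N_gt0].
  move: zN; rewrite N0 expr0 => /eqP; rewrite -subr_eq0 opprK -mulr2n.
  by rewrite pnatr_eq0.
case: leqP => // szp.
suff /(congr1 (fun q : {poly K} => q`_((size p).-1 - N))) : p^`N(N) = 0.
  have N_le : (N <= (size p).-1)%N by rewrite -ltnS (ltn_predK szp).
  rewrite coef_nderivn coef0 subnKC // => /eqP; rewrite mulrn_eq0.
  rewrite -lead_coefE lead_coef_eq0 eqn0Ngt bin_gt0 N_le /= => /eqP p0.
  by rewrite p0 size_poly0 in szp.
apply: (poly_eq0_seq (@natr_injective K)) => n; set u := n%:R.
pose S i := \sum_(k < 2 * N) (-1) ^+ k * (z ^+ k) ^+ i.
pose q := \poly_(i < size p) (p^`N(i).[u] * S i).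
have q0 : q = 0.
  apply: (poly_eq0_seq (@natr_injective K)) => y.
  rewrite horner_poly -[RHS](sum0 u y%:R).
  under [RHS]eq_bigr => k _.
    rewrite nderiv_taylor; last exact: mulrC.
    rewrite mulr_sumr; over.
  rewrite [RHS]exchange_big; apply: eq_bigr => i _ /=.
  rewrite /S mulr_sumr mulr_suml; apply: eq_bigr => k _.
  by rewrite exprMn; ring.
have : q`_N = 0 by rewrite q0 coef0.
rewrite coef_poly szp /S => /eqP; rewrite mulf_eq0 => /orP [/eqP //|].
rewrite (eq_bigr (fun=> 1)) => [|k _]; last first.
  by rewrite exprAC zN -exprMn mulrNN mulr1 expr1n.
by rewrite sumr_const card_ord pnatr_eq0 muln_eq0 /= eqn0Ngt N_gt0.
Qed.

(** * The Haruki equation *)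

Lemma haruki_alternating (R : realType) (N : nat) (eta : R[i])
    (f : R[i] -> R[i]) :
  haruki_equation N eta f <->
  forall x y, \sum_(k < 2 * N) (-1) ^+ k * f (x + eta ^+ k * y) = 0.
Proof.
have E x y : \sum_(k < 2 * N) (-1) ^+ k * f (x + eta ^+ k * y) =
    \sum_(k < N) f (x + eta ^+ (2 * k) * y) -
    \sum_(k < N) f (x + eta ^+ (2 * k + 1) * y).
  elim: N => [|n IHn]; first by rewrite muln0 !big_ord0 subr0.
  rewrite mulnS 2!big_ord_recr 2![in RHS]big_ord_recr /= IHn addn1 exprS.
  by rewrite exprM sqrrN !expr1n; ring.
split=> [H x y|H x y]; first by rewrite E H subrr.
by apply/eqP; rewrite -subr_eq0 -E H.
Qed.

Section PrimitiveRoot.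
Variables (R : realType) (N : nat) (eta : R[i]).
Hypothesis (N_gt0 : (0 < N)%N) (prim_eta : (2 * N).-primitive_root eta).

Lemma prim_root_half : eta ^+ N = -1.
Proof.
have : (eta ^+ N) ^+ 2 == 1 by rewrite -exprM mulnC (prim_expr_order prim_eta).
rewrite sqrf_eq1 => /orP [|/eqP //].
rewrite -(prim_order_dvd prim_eta) => /(dvdn_leq N_gt0).
by rewrite leqNgt -{1}[N]mul1n ltn_pmul2r.
Qed.

Lemma prim_root_conj : eta * eta^* = 1.
Proof.
rewrite -sqr_normc; suff -> : `|eta| = 1 by rewrite expr1n.
apply/eqP; rewrite -(@pexpr_eq1 _ _ (2 * N)) ?muln_gt0 //.
by rewrite -normrX (prim_expr_order prim_eta) normr1.
Qed.

(** A geometric sum with [2N] terms whose ratio [r] satisfies [r^(2N) = 1].  If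
    [r] were [1], then [eta^(N + i) = eta^j], which is impossible because
    [j < N <= N + i < 2N]. *)
Lemma alternating_monomial_sum (i j : nat) : (i < N)%N -> (j < N)%N ->
  \sum_(k < 2 * N) (-1) ^+ k * ((eta ^+ k) ^+ i * ((eta ^+ k)^* ) ^+ j) = 0.
Proof.
move=> iN jN; pose r := -1 * (eta ^+ i * eta^* ^+ j).
have r1 : r != 1.
  apply/eqP => /(congr1 (fun z => z * eta ^+ j)).
  rewrite /r mulN1r mulNr -mulrA -exprMn [_^* * _]mulrC prim_root_conj.
  rewrite expr1n mulr1 mul1r.
  rewrite -mulN1r -prim_root_half -exprD => /eqP.
  rewrite (eq_prim_root_expr prim_eta) !modn_small.
  - by rewrite gtn_eqF // ltn_addr.
  - by rewrite mul2n -addnn ltn_addr.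
  - by rewrite mul2n -addnn ltn_add2l.
have : (r - 1) * \sum_(k < 2 * N) r ^+ k = 0.
  rewrite -subrX1 /r !exprMn exprM sqrrN !expr1n mul1r.
  rewrite -(exprAC eta) -(exprAC eta^* ) -rmorphXn (prim_expr_order prim_eta).
  by rewrite rmorph1 !expr1n mulr1 subrr.
move/eqP; rewrite mulf_eq0 subr_eq0 (negPf r1) /= => /eqP r0; rewrite -[RHS]r0.
apply: eq_bigr => k _.
by rewrite rmorphXn /r !exprMn exprAC [(_^* ^+ k) ^+ j]exprAC.
Qed.

Lemma bipoly_haruki (a : 'M[R[i]]_N) :
  haruki_equation N eta (fun z => bipoly a z z^*).
Proof.
apply/haruki_alternating => x y.
under eq_bigr => k _ do rewrite /bipoly mulr_sumr.
rewrite exchange_big big1 // => i _.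
under eq_bigr => k _ do rewrite mulr_sumr.
rewrite exchange_big big1 // => j _ /=.
under eq_bigr => k _.
  rewrite rmorphD rmorphM !exprDn -mulrA big_distrlr !mulr_sumr; over.
rewrite exchange_big big1 // => s _ /=.
under eq_bigr => k _ do rewrite !mulr_sumr.
rewrite exchange_big big1 // => t _ /=.
(* What remains of the term of index [(s, t)] outside the sum over [k]. *)
pose c := a i j * (x ^+ (i - s) * y ^+ s *+ 'C(i, s)) *
  (x^* ^+ (j - t) * y^* ^+ t *+ 'C(j, t)).
rewrite -[RHS](mulr0 c) -[X in _ = _ * X](@alternating_monomial_sum s t).
- rewrite mulr_sumr; apply: eq_bigr => k _; rewrite /c !exprMn.
  by ring.
- by apply: leq_ltn_trans (ltn_ord i); rewrite -ltnS.
- by apply: leq_ltn_trans (ltn_ord j); rewrite -ltnS.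
Qed.

Lemma bipoly_continuous (a : 'M[R[i]]_N) :
  continuousC (fun z => bipoly a z z^*).
Proof.
apply: continuousC_sum => i; apply: continuousC_sum => j.
apply: continuousC_mul; last exact/continuousC_exp/continuousC_conj.
apply: continuousC_mul; first exact: continuousC_cst.
exact/continuousC_exp/continuousC_id.
Qed.

Variables (f : R[i] -> R[i]).
Hypothesis (f_cont : continuousC f) (f_haruki : haruki_equation N eta f).

Lemma haruki_fdiff h x : iter (2 * N).-1 (fdiff h) f x = 0.
Proof.
have N2 : (2 * N).-1.+1 = (2 * N)%N by rewrite prednK // muln_gt0.
have f0 : f = (fun z => (-1) ^+ 0 * f z) by apply/funext => z; rewrite mul1r.
rewrite [f in LHS]f0.
apply: (eliminate_terms (a := fun k => eta ^+ k)
  (g := fun k z => (-1) ^+ k * f z)).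
  have lt_2N k : (k <= (2 * N).-1)%N -> (k < 2 * N)%N.
    by move=> kN; rewrite -N2 ltnS.
  move=> k l; rewrite !inE => /lt_2N kN /lt_2N lN /eqP.
  rewrite (eq_prim_root_expr prim_eta).
  rewrite (modn_small kN) (modn_small lN).
  by move/eqP.
by rewrite N2; apply/haruki_alternating.
Qed.

Lemma haruki_real_bipoly :
  exists a : 'M[R[i]]_((2 * N).-1), forall s t : R,
    f (s%:C + 'i * t%:C) = bipoly a s%:C t%:C.
Proof.
pose T (u : R[i]) := exists s : R, u = s%:C.
have [n|v [t ->]|u [s ->]|a fa] :=
  @bipoly_interpolation _ T (2 * N).-1 (fun u v => f (u + 'i * v)).
- by exists n%:R; rewrite rmorph_nat.
- have [p szp fp] := poly_on_real_lines f_cont haruki_fdiff ('i * t%:C) 1.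
  by exists p => // w [s ->]; rewrite -fp mul1r addrC.
- have [p szp fp] := poly_on_real_lines f_cont haruki_fdiff s%:C 'i.
  by exists p => // w [t ->].
by exists a => s t; apply: fa; [exists s|exists t].
Qed.

Lemma haruki_bipoly : exists a : 'M[R[i]]_N, forall z, f z = bipoly a z z^*.
Proof.
have [b fb] := haruki_real_bipoly.
(* The arguments are [Re z] and [Im z] when [u = z] and [v = z^*]. *)
pose F u v := bipoly b (0 + 2^-1 * u + 2^-1 * v)
  (0 + (- 'i / 2) * u + ('i / 2) * v).
have FP : poly_along_lines F.
  exact/poly_along_lines_affine/poly_along_lines_bipoly.
have fF z : f z = F z z^*.
  rewrite [in LHS](complexE z) fb ReJ_add ImJ_sub /F !add0r.
  congr bipoly; first by rewrite mulrDl ![2^-1 * _]mulrC.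
  by rewrite -mulrA mulrC mulrBr addrC !mulNr ['i / _]mulrC.
(* The equation for [F], where first the conjugate of [x] and then that of [y]
   become independent variables. *)
have F_sum y u v :
    \sum_(k < 2 * N)
      (-1) ^+ k * F (u + eta ^+ k * y) (v + (eta ^+ k * y)^* ) = 0.
  move: u v; apply: eq0_on_conjugates => [|z].
    apply: poly_along_lines_sum => k; apply: poly_along_lines_scale.
    move=> a11 b11 c11 d11.
    have [p Fp] := FP (a11 + eta ^+ k * y) b11 (c11 + (eta ^+ k * y)^* ) d11.
    by exists p => w; rewrite -Fp; congr F; ring.
  rewrite -[RHS]((haruki_alternating N eta f).1 f_haruki z y).
  by apply: eq_bigr => k _; rewrite fF rmorphD.
have {}F_sum u v y y' :
    \sum_(k < 2 * N)
      (-1) ^+ k * F (u + eta ^+ k * y) (v + eta^* ^+ k * y') = 0.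
  move: y y'; apply: eq0_on_conjugates => [|y].
    apply: poly_along_lines_sum => k; apply: poly_along_lines_scale.
    move=> a11 b11 c11 d11.
    have [p Fp] := FP (u + eta ^+ k * a11) (eta ^+ k * b11)
      (v + eta^* ^+ k * c11) (eta^* ^+ k * d11).
    by exists p => w; rewrite -Fp; congr F; ring.
  rewrite -[RHS](F_sum y u v).
  by apply: eq_bigr => k _; rewrite rmorphM rmorphXn.
have [//|v _|u _|a Fa] := @bipoly_interpolation _ (fun=> True) N F.
- have [p Fp] := FP 0 1 v 0.
  have {}Fp u : F u v = p.[u] by rewrite -Fp; congr F; ring.
  exists p => //; apply: (size_le_of_alternating_sum prim_root_half) => u y.
  rewrite -[RHS](F_sum u v y 0).
  by apply: eq_bigr => k _; rewrite -Fp mulr0 addr0.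
- have [p Fp] := FP u 0 0 1.
  have {}Fp v : F u v = p.[v] by rewrite -Fp; congr F; ring.
  exists p => //; apply: (size_le_of_alternating_sum (z := eta^* )) => [|v y].
    by rewrite -rmorphXn prim_root_half rmorphN1.
  rewrite -[RHS](F_sum u v 0 y).
  by apply: eq_bigr => k _; rewrite -Fp mulr0 addr0.
by exists a => z; rewrite fF Fa.
Qed.

End PrimitiveRoot.

Theorem theorem2p1 (R : realType) (N : nat) (eta : R[i])
    (hN : (1 <= N)%N) (heta : (2 * N).-primitive_root eta) :
  haruki_space N eta = bipolynomial_space R N.
Proof.
apply/seteqP; split => f [].
  move=> f_cont f_haruki.
  have [a fa] := haruki_bipoly hN heta f_cont f_haruki.
  by exists a; apply/funext => z; rewrite fa.
by move=> a ->; split; [exact: bipoly_continuous|exact: bipoly_haruki].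
Qed.
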